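(* Let $(P,\preceq,\wedge,\hat 0)$ be a locally finite meet semilattice with smallest element $\hat 0$, let $S=\{x_1,\ldots,x_n\}$ be a finite, meet closed subset of $P$ (with $x_1,\dots,x_n$ distinct) ordered so that $x_i\preceq x_j$ only if $i\leq j$, and let $f:P\to\mathbb{C}$ be a function. Then the $n$-dimensional meet tensor $(S_d)_f$ of order $d$ has a rank-$n$ tensor-train decomposition $$((S_d)_f)_{i_1,\ldots,i_d}=G_1(i_1)\left(\prod_{k=2}^{d-1}G(i_k)\right)G_d(i_d),\qquad i_1,\ldots,i_d\in\{1,\ldots,n\},$$ where the product is a product of matrices taken in the order of increasing $k$, and the TT cores $G_1$ (with each $G_1(i)$ a $1\times n$ matrix), $G$ (with each $G(i)$ an $n\times n$ matrix), and $G_d$ (with each $G_d(i)$ an $n\times 1$ matrix) are defined by setting $$G_1(i)_{1,j}=D_jE_{i,j},\quad G(i)_{j,k}=\delta_{j,k}E_{i,k},\quad G_d(i)_{j,1}=E_{i,j}$$ for all $i,j,k\in\{1,\ldots,n\}$. The number of nonzero elements in each core is equal to $$\sum_{z\in S}\#\{y\in S: y\preceq z\}.$$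
   Context: A poset $(P,\preceq)$ is locally finite if $\{z\in P\mid x\preceq z\preceq y\}$ is finite for all $x,y\in P$. It is a meet semilattice if every two elements $x,y\in P$ have a greatest lower bound $x\wedge y$ (their meet). The element $\hat 0\in P$ satisfies $\hat 0\preceq x$ for all $x\in P$. A subset $S$ is meet closed if $x\wedge y\in S$ for all $x,y\in S$. The order $d$ meet tensor on $S$ with respect to $f$ is the $n$-dimensional tensor (array of $n^d$ entries) with $$((S_d)_f)_{i_1,\ldots,i_d}=f(x_{i_1}\wedge\cdots\wedge x_{i_d}),\quad i_1,\ldots,i_d\in\{1,\ldots,n\}.$$ A tensor-train (TT) decomposition of a tensor $A$ of order $d$ is a representation $A_{i_1,\ldots,i_d}=G_1(i_1)\cdots G_d(i_d)$, where each $G_k(i_k)$ is an $r_{k-1}\times r_k$ matrix and $r_0=r_d=1$; the three-dimensional arrays $G_k$ are the TT cores and the $r_k$ are the compression ranks. ''Rank-$n$'' means that the compression ranks $r_1,\ldots,r_{d-1}$ of the representation are equal to $n$. Here $\delta_{j,k}$ is the Kronecker delta, the $n\times n$ matrix $E$ is given by $E_{i,j}=1$ if $x_j\preceq x_i$ and $E_{i,j}=0$ otherwise, and $$D_k=\sum_{\substack{z\preceq x_k\\ z\not\preceq x_j,\ j<k}}\ \sum_{\hat 0\preceq y\preceq z}f(y)\mu_P(y,z),\quad k\in\{1,\ldots,n\},$$ where the outer sum is over $z\in P$ with $z\preceq x_k$ and $z\not\preceq x_j$ for all $j<k$, and $\mu_P$ is the Möbius function of $P$: $\mu_P(x,y)=1$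 if $x=y$, $\mu_P(x,y)=-\sum_{x\preceq z\prec y}\mu_P(x,z)$ if $x\prec y$, and $\mu_P(x,y)=0$ otherwise.
   Formalization: For the first core G_1 the number of nonzero elements is at most the stated sum, with equality if and only if all D_j are nonzero; the claimed equality fails otherwise, e.g. for f = 0 and n = 1. *)

(* Defs.v *)
From HB Require Import structures.
From mathcomp Require Import all_boot all_order all_algebra finmap.
From mathcomp Require Import boolp classical_sets functions cardinality fsbigop.
From mathcomp Require Import reals zify.
From mathcomp Require Export complex.

Set Implicit Arguments.
Unset Strict Implicit.
Unset Printing Implicit Defensive.

Import Order.TTheory GRing.Theory Num.Theory.

Local Open Scope classical_set_scope.
Local Open Scope ring_scope.

Section Moebius.
Context {disp : Order.disp_t} {P : porderType disp}.

Definition locally_finite : Prop :=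
  forall x y : P, finite_set [set z | (x <= z <= y)%O].

(* The recursion on intervals is run on a natural number bounding the
   cardinality of [x, y]; see moebiusE for the usual recursive equation. *)
Fixpoint moebius_rec (m : nat) (x y : P) : int :=
  if m is m'.+1 then
    if x == y then 1
    else if (x < y)%O then
      - \sum_(z \in [set z | (x <= z < y)%O]) moebius_rec m' x z
    else 0
  else 0.

Definition moebius (x y : P) : int :=
  moebius_rec #|` fset_set [set z : P | (x <= z <= y)%O]| x y.

Hypothesis Pfin : locally_finite.

Let itv_card (x y : P) : nat := #|` fset_set [set z : P | (x <= z <= y)%O]|.

Let mem_itv (x y t : P) :
  (t \in fset_set [set z : P | (x <= z <= y)%O]) = (x <= t <= y)%O.
Proof.
by rewrite in_fset_set; [exact/asboolP/idP | exact: Pfin].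
Qed.

Let itv_card_gt0 (x y : P) : (x <= y)%O -> (0 < itv_card x y)%N.
Proof.
move=> xy; rewrite cardfs_gt0; apply/fset0Pn; exists x.
by rewrite mem_itv lexx.
Qed.

Let itv_card_lt (x z y : P) :
  (x <= z)%O -> (z < y)%O -> (itv_card x z < itv_card x y)%N.
Proof.
move=> xz zy; apply: fproper_ltn_card; rewrite fproperEneq; apply/andP; split.
  apply/eqP => /fsetP/(_ y); rewrite !mem_itv.
  by rewrite (lt_geF zy) andbF lexx (le_trans xz (ltW zy)).
apply/fsubsetP => t; rewrite !mem_itv.
by move=> /andP[-> tz]; exact: le_trans tz (ltW zy).
Qed.

Let moebius_rec_stable (m : nat) (x y : P) :
  (itv_card x y <= m)%N -> moebius_rec m x y = moebius x y.
Proof.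
suff H k m1 m2 u v : (m1 <= k)%N -> (itv_card u v <= m1)%N ->
    (itv_card u v <= m2)%N -> moebius_rec m1 u v = moebius_rec m2 u v.
  by move=> xym; exact: (H m).
have base p w a b : (itv_card a b <= 0)%N -> moebius_rec p a b = w -> w = 0.
  move=> c0; have nuv : (a <= b)%O = false.
    by apply: contraTF c0 => /itv_card_gt0; rewrite -ltnNge.
  case: p => [|p] <- //=; case: eqVneq nuv => [->|_ nuv]; first by rewrite lexx.
  by case: ifP => [/ltW|//]; rewrite nuv.
elim: k m1 m2 u v => [|k IH] [|m1] [|m2] u v m1k c1 c2 //.
- by rewrite (base m2.+1 _ _ _ c1 erefl).
- by rewrite (base m2.+1 _ _ _ c1 erefl).
- by rewrite (base m1.+1 _ _ _ c2 erefl).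
rewrite /=.
case: eqVneq => // _; case: ifP => // uv; congr (- _).
apply: eq_fsbigr => z /set_mem /andP[uz zv].
by have := itv_card_lt uz zv => lt; apply: IH; lia.
Qed.

Lemma moebiusE (x y : P) : moebius x y =
  if x == y then 1
  else if (x < y)%O then - \sum_(z \in [set z | (x <= z < y)%O]) moebius x z
  else 0.
Proof.
rewrite -(@moebius_rec_stable (itv_card x y).+1) //=.
case: eqVneq => // _; case: ifP => // xy; congr (- _).
apply: eq_fsbigr => z /set_mem /andP[xz zy].
by apply: moebius_rec_stable; rewrite ltnW// itv_card_lt.
Qed.

End Moebius.
Arguments locally_finite {disp} P.

Section MeetTensor.
Context {disp : Order.disp_t} {P : bMeetSemilatticeType disp}.
Context {C : pzRingType} {n : nat}.
Implicit Types (f : P -> C) (S : n.-tuple P).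

(* The order is d.+1. As P need not have a greatest element, the iterated meet
   is started from the first point rather than from a neutral element. *)
Definition meet_tensor (d : nat) f S (i : 'I_d.+1 -> 'I_n) : C :=
  f (\big[Order.meet/tnth S (i ord0)]_(k < d) tnth S (i (lift ord0 k))).

Definition order_mx S : 'M[C]_n :=
  \matrix_(i, j) (tnth S j <= tnth S i)%O%:R.

Definition meet_coef f S (k : 'I_n) : C :=
  \sum_(z \in [set z : P | (z <= tnth S k)%O /\
                 forall j : 'I_n, (j < k)%N -> ~~ (z <= tnth S j)%O])
    \sum_(y \in [set y : P | (\bot <= y <= z)%O]) f y * (moebius y z)%:~R.

(* An entry of this core vanishes on the support of order_mx when meet_coef f S j
   does (e.g. for f = 0), so its number of nonzero entries depends on f. *)
Definition core_first f S (i : 'I_n) : 'rV[C]_n :=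
  \row_j (meet_coef f S j * order_mx S i j).

Definition core_mid S (i : 'I_n) : 'M[C]_n :=
  \matrix_(j, k) ((j == k)%:R * order_mx S i k).

Definition core_last S (i : 'I_n) : 'cV[C]_n :=
  \col_j order_mx S i j.

(* TT decompositions of a tensor of order d.+2 whose compression ranks
   r_1, ..., r_(d+1) are all equal to r; the modes are numbered from 0. The
   iterated product of matrices is in increasing order of k. *)
Definition tt_decomposition (d r : nat) (A : ('I_d.+2 -> 'I_n) -> C)
    (G1 : 'I_n -> 'rV[C]_r) (G : 'I_d.+2 -> 'I_n -> 'M[C]_r)
    (Gd : 'I_n -> 'cV[C]_r) : Prop :=
  forall i : 'I_d.+2 -> 'I_n,
    A i = (G1 (i ord0)
           *m (\big[mulmx/1%:M]_(k < d.+2 | (0 < k < d.+1)%N) G k (i k))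
           *m Gd (i ord_max)) ord0 ord0.

Definition nnz (p q : nat) (G : 'I_n -> 'M[C]_(p, q)) : nat :=
  #|[pred t : 'I_n * 'I_p * 'I_q | G t.1.1 t.1.2 t.2 != 0]|.

End MeetTensor.

(* Main.v *)
Require Import Defs.
From mathcomp Require Import all_boot all_order all_algebra reals.
From mathcomp Require Import finmap boolp classical_sets cardinality fsbigop.

(** The decomposition is a factorization of the meet tensor through a diagonal
    tensor. Put g(z) = sum over y <= z of f(y) mu(y, z), so that Moebius
    inversion gives f(x) as the sum of g over the principal down-set of x
    ([moebius_inversion]). The elements below some member of S are split into
    blocks, z being put in block k when k is the least index with z <= x_k;
    D_k is the sum of g over block k.

    The point where meet closure and the linear extension property are used is
    that the down-set of x_m is a union of blocks, namely of those with
    x_k <= x_m ([block_le]). Hence f(x_m) is the sum of the D_k over the k with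
    x_k <= x_m ([sum_meet_coef]). A meet of members of S is some x_m, and lying
    below it means lying below each of its factors; therefore the entry of the
    meet tensor at (i_1, ..., i_d) is
      sum over j of D_j E(i_1, j) ... E(i_d, j)
    with E the order matrix ([meet_tensorE]). The tensor train has the same
    entries, because its middle
    cores are diagonal matrices, whose product is computed pointwise
    ([tt_entryE]).

    Entry counts follow as E is a 0-1 matrix whose support is the order on S.
    In the first core the column j of E is multiplied by D_j; since E has a
    unit diagonal, each vanishing D_j destroys at least one entry, which gives
    the equality case ([nnz_core_first]). *)

Import Order.TTheory GRing.Theory Num.Theory.
Local Open Scope ring_scope.
Local Open Scope complex_scope.

(** * Moebius inversion below a point *)

Section MoebiusInversion.
Context {disp : Order.disp_t} {P : bMeetSemilatticeType disp}.
Hypothesis Pfin : locally_finite P.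
Implicit Types x y z : P.

(** The principal down-set of [x], written as an interval from [\bot] because
    local finiteness speaks of intervals. *)
Definition lower x : {fset P} := fset_set [set z | (\bot <= z <= x)%O]%classic.

Lemma mem_lower x z : (z \in lower x) = (z <= x)%O.
Proof.
rewrite in_fset_set; last exact: Pfin.
by apply/asboolP/idP => /=; rewrite le0x.
Qed.

(** All the finitely supported sums that occur are sums over part of a principal
    down-set; moving them to filtered sums over one fixed finite enumeration
    gives access to the exchange lemmas for iterated operators. *)
Lemma fsum_lower (V : nmodType) x (p : pred P) (A : set P) (F : P -> V) :
    (forall z, A z <-> p z) -> (forall z, p z -> (z <= x)%O) ->
  \sum_(z \in A) F z = \sum_(z <- lower x | p z) F z.
Proof.
move=> Ap px.
have -> : A = [set z | z \in [seq z <- lower x | p z]]%classic.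
  apply/seteqP; split=> z /=.
    by move=> /Ap pz; rewrite mem_filter pz mem_lower px.
  by rewrite mem_filter => /andP[/Ap].
by rewrite -fsbig_seq ?filter_uniq ?fset_uniq// big_filter.
Qed.

(** The recursive definition of the Moebius function is this identity, solved
    for the top term of the sum; [y <= z] alone bounds the interval, as
    [lower x] bounds it from above. *)
Lemma sum_moebius x y : (y <= x)%O ->
  \sum_(z <- lower x | (y <= z)%O) moebius y z = (y == x)%:R.
Proof.
move=> yx; rewrite (big_rem x) ?mem_lower//= yx.
rewrite rem_filter ?fset_uniq// big_filter_cond /=.
rewrite moebiusE//; case: eqVneq yx => [-> _|yNx yx].
  rewrite big_seq_cond big1 ?addr0// => z /and3P[]; rewrite mem_lower => zx zNx xz.
  by move: zNx; rewrite /= eq_le zx xz.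
rewrite lt_neqAle yNx yx /= (@fsum_lower _ x (fun z => (y <= z < x)%O))//; last first.
  by move=> z /andP[_ /ltW].
apply/eqP; rewrite addrC subr_eq0; apply/eqP.
rewrite big_seq_cond [RHS]big_seq_cond; apply: eq_bigl => z.
by rewrite mem_lower lt_neqAle /=; case: (z <= x)%O; rewrite ?andbT//= andbC.
Qed.

(** After exchanging the two sums, the coefficient of [f y] is the sum of
    [moebius y] over the interval from [y] to [x], which vanishes unless
    [y = x]. *)
Lemma moebius_inversion (C : pzRingType) (f : P -> C) x :
  \sum_(z <- lower x)
    \sum_(y \in [set y | (\bot <= y <= z)%O]%classic) f y * (moebius y z)%:~R
  = f x.
Proof.
transitivity (\sum_(z <- lower x) \sum_(y <- lower x | (y <= z)%O)
                 f y * (moebius y z)%:~R).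
  rewrite big_seq [RHS]big_seq; apply: eq_bigr => z; rewrite mem_lower => zx.
  apply: fsum_lower => y /=; first by rewrite le0x.
  by move=> yz; exact: le_trans zx.
rewrite (exchange_big_dep predT)//=.
have E y : y \in lower x ->
    \sum_(z <- lower x | (y <= z)%O) f y * (moebius y z)%:~R
    = if y == x then f y else 0.
  rewrite mem_lower => yx; rewrite -mulr_sumr -rmorph_sum sum_moebius//.
  by case: eqP; rewrite ?mulr1 ?mulr0.
rewrite (eq_big_seq _ E) -big_mkcond /= (big_rem x) ?mem_lower//= eqxx.
rewrite rem_filter ?fset_uniq// big_filter_cond /= big_pred0 ?addr0// => z.
by rewrite /= andNb.
Qed.

End MoebiusInversion.

(** * Diagonalization of the meet tensor *)

Section Diagonalization.
Context {disp : Order.disp_t} {P : bMeetSemilatticeType disp}.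
Hypothesis Pfin : locally_finite P.
Context {n : nat} (S : n.-tuple P).
Hypothesis Smeet : {in S &, forall x y, (x `&` y)%O \in S}.
Hypothesis Sord : forall i j : 'I_n, (tnth S i <= tnth S j)%O -> (i <= j)%N.

Definition block (k : 'I_n) : pred P :=
  fun z => (z <= tnth S k)%O && [forall (j : 'I_n | (j < k)%N), ~~ (z <= tnth S j)%O].

(** If [z] lies in block [k] and below [x_m], then it lies below their meet, a
    member [x_l] of [S]. Being below [x_k], this [x_l] has [l <= k], and the
    minimality of [k] forces [l = k]; so [x_k] is its own meet with [x_m]. *)
Lemma block_le (m k : 'I_n) z :
  (z <= tnth S m)%O -> block k z -> (tnth S k <= tnth S m)%O.
Proof.
move=> zm /andP[zk /forall_inP zN].
have /tnthP[l Dl] := Smeet _ _ (mem_tnth k S) (mem_tnth m S).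
have lk : (l <= k)%N by apply: Sord; rewrite -Dl leIl.
have zl : (z <= tnth S l)%O by rewrite -Dl lexI zk zm.
have <- : l = k.
  by apply/eqP; move: lk; rewrite leq_eqVlt => /predU1P[/val_inj->//|/zN]; rewrite zl.
by rewrite -Dl leIr.
Qed.

Lemma block_exists (m : 'I_n) z : (z <= tnth S m)%O -> exists k, block k z.
Proof.
move=> zm; have := @arg_minnP _ m (fun k => z <= tnth S k)%O (fun k => k : nat) zm.
case=> k zk kmin.
exists k; rewrite /block zk; apply/forall_inP => j.
by apply: contraL => /kmin; rewrite -leqNgt.
Qed.

Lemma block_inj k l z : block k z -> block l z -> k = l.
Proof.
move=> /andP[zk /forall_inP kN] /andP[zl /forall_inP lN].
by case: (ltngtP k l) => [/lN|/kN|/val_inj//]; rewrite ?zk ?zl.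
Qed.

(** The blocks selected by row [m] of the order matrix partition the down-set of
    the [m]-th point, so this is Moebius inversion with its sum regrouped. *)
Lemma sum_meet_coef {C : pzRingType} (f : P -> C) (m : 'I_n) :
  \sum_k meet_coef f S k * order_mx S m k = f (tnth S m).
Proof.
rewrite -[RHS](moebius_inversion Pfin).
pose g z : C := \sum_(y \in [set y | (\bot <= y <= z)%O]%classic)
                   f y * (moebius y z)%:~R.
transitivity (\sum_k \sum_(z <- lower (tnth S m) | block k z) g z).
  apply: eq_bigr => k _; rewrite mxE; case: (boolP (_ <= _)%O) => [km|kNm].
    rewrite mulr1; apply: fsum_lower => // z.
      split=> [[zk zN]|/andP[zk /forall_inP zN]] //.
      by rewrite /block zk; apply/forall_inP.
    by move=> /andP[zk _]; exact: le_trans km.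
  (* An unselected block does not meet the down-set at all. *)
  rewrite mulr0 big_seq_cond big_pred0// => z; rewrite mem_lower//.
  by apply/negbTE; apply: contra kNm => /andP[]; exact: block_le.
rewrite (exchange_big_dep predT)//= big_seq [RHS]big_seq.
apply: eq_bigr => z; rewrite mem_lower// => zm.
have [k kz] := block_exists _ _ zm.
by rewrite (big_pred1 k)// => l; apply/idP/eqP => [lz|->//]; exact: block_inj lz kz.
Qed.

Lemma tensor_meet_mem d (i : 'I_d.+1 -> 'I_n) :
  \big[Order.meet/tnth S (i ord0)]_(k < d) tnth S (i (lift ord0 k)) \in S.
Proof. by elim/big_ind: _ => *; rewrite ?mem_tnth ?Smeet. Qed.

Lemma le_tensor_meet d (i : 'I_d.+1 -> 'I_n) x :
  (x <= \big[Order.meet/tnth S (i ord0)]_(k < d) tnth S (i (lift ord0 k)))%O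
  = [forall k, (x <= tnth S (i k))%O].
Proof.
have -> : [forall k, (x <= tnth S (i k))%O] =
    (x <= tnth S (i ord0))%O && [forall k : 'I_d, (x <= tnth S (i (lift ord0 k)))%O].
  apply/forallP/andP => [H|[x0 /forallP xS] k]; first by split=> //; apply/forallP.
  by case: (unliftP ord0 k) => [j|] ->.
rewrite -(big_andE predT); elim: (index_enum _) => [|k r IHr]; rewrite ?big_nil ?andbT//.
by rewrite !big_cons lexI IHr andbCA.
Qed.

(** The order matrix entry at the meet is the product of the entries at the
    factors, since a lower bound of the meet is a common lower bound. *)
Lemma meet_tensorE {C : pzRingType} (f : P -> C) d (i : 'I_d.+1 -> 'I_n) :
  meet_tensor f S i
  = \sum_j meet_coef f S j * \prod_k order_mx S (i k) j.
Proof.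
rewrite /meet_tensor; have /tnthP[m Dm] := tensor_meet_mem _ i.
rewrite Dm -sum_meet_coef; apply: eq_bigr => j _; congr (_ * _).
rewrite mxE -Dm le_tensor_meet -(big_andE predT).
elim: (index_enum _) => [|k r IHr]; rewrite ?big_nil// !big_cons -IHr mxE.
by rewrite -natrM mulnb.
Qed.

End Diagonalization.

(** * The tensor train *)

Section TensorTrain.
Context {disp : Order.disp_t} {P : bMeetSemilatticeType disp}.
Context {C : pzRingType} {n : nat} (S : n.-tuple P).

Lemma big_core_mid d (i : 'I_d -> 'I_n) (Q : pred 'I_d) :
  \big[mulmx/1%:M]_(k < d | Q k) core_mid (C := C) S (i k)
  = diag_mx (\row_j \prod_(k < d | Q k) order_mx S (i k) j).
Proof.
elim: (index_enum _) => [|k r IHr].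
  by rewrite big_nil; apply/matrixP => a b; rewrite !mxE big_nil.
rewrite big_cons IHr; case: ifP => Qk.
  apply/matrixP => a b; rewrite mul_mx_diag !mxE big_cons Qk !mxE.
  by case: eqP => [->|]; rewrite ?mul1r ?mul0r ?mulr1n ?mulr0n.
by congr diag_mx; apply/rowP => j; rewrite !mxE big_cons Qk.
Qed.

(** With the middle cores collapsed to a single diagonal matrix, the product of
    the train is a single sum over the diagonal. *)
Lemma tt_entryE (f : P -> C) d (i : 'I_d.+2 -> 'I_n) :
  (core_first f S (i ord0)
   *m (\big[mulmx/1%:M]_(k < d.+2 | (0 < k < d.+1)%N) core_mid S (i k))
   *m core_last S (i ord_max)) ord0 ord0
  = \sum_j meet_coef f S j * \prod_k order_mx S (i k) j.
Proof.
rewrite big_core_mid mul_mx_diag mxE; apply: eq_bigr => j _; rewrite !mxE -!mulrA.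
congr (_ * _); rewrite big_ord_recl big_ord_recr /= !mxE; congr (_ * (_ * _)).
  (* The range condition removes exactly the first and the last mode. *)
  rewrite big_mkcond big_ord_recl big_ord_recr /= ltnn mul1r mulr1.
  by apply: eq_bigr => k _; rewrite /bump add1n ltnS ltn_ord.
by congr (_ (_ <= tnth S (i _))%O)%:R; apply: val_inj.
Qed.

End TensorTrain.

(** * Counting nonzero entries *)

Section Nonzero.
Context {disp : Order.disp_t} {P : bMeetSemilatticeType disp}.
Context {C : nzRingType} {n : nat} (S : n.-tuple P).

Lemma nnzE p q (G : 'I_n -> 'M[C]_(p, q)) :
  nnz G = (\sum_i \sum_j \sum_k (G i j k != 0%R))%N.
Proof.
by rewrite !pair_bigA /nnz -sum1_card big_mkcond; apply: eq_bigr => t _; rewrite inE; case: ifP.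
Qed.

Lemma order_mx_neq0 i j : (order_mx (C := C) S i j != 0) = (tnth S j <= tnth S i)%O.
Proof. by rewrite mxE; case: (_ <= _)%O; rewrite ?oner_eq0 ?eqxx. Qed.

Lemma sum_count_le :
  (\sum_(z <- S) count (fun y => (y <= z)%O) S)%N
  = (\sum_i \sum_j (tnth S j <= tnth S i)%O)%N.
Proof.
rewrite big_tuple; apply: eq_bigr => i _; rewrite -sum1_count big_mkcond big_tuple.
by apply: eq_bigr => j _; case: ifP.
Qed.

Lemma nnz_core_last :
  nnz (core_last (C := C) S) = (\sum_(z <- S) count (fun y => (y <= z)%O) S)%N.
Proof.
rewrite nnzE sum_count_le; apply: eq_bigr => i _; apply: eq_bigr => j _.
by rewrite big_ord1 mxE order_mx_neq0.
Qed.

Lemma nnz_core_mid :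
  nnz (core_mid (C := C) S) = (\sum_(z <- S) count (fun y => (y <= z)%O) S)%N.
Proof.
rewrite nnzE sum_count_le; apply: eq_bigr => i _; apply: eq_bigr => j _.
rewrite (bigD1 j)//= big1 ?addn0 => [|k kNj].
  by rewrite mxE eqxx mul1r order_mx_neq0.
by rewrite mxE [j == k]eq_sym (negbTE kNj) mul0r eqxx.
Qed.

(** Equality of the sums means equality term by term: [D_j] may vanish for no
    [j] that lies below some [i], and every [j] lies below itself. *)
Lemma nnz_core_first (f : P -> C) :
  (nnz (core_first f S) <= \sum_(z <- S) count (fun y => (y <= z)%O) S
     ?= iff [forall j, meet_coef f S j != 0%R])%N.
Proof.
rewrite nnzE sum_count_le.
rewrite (_ : [forall j, _] =
   [forall i, forall j, (tnth S j <= tnth S i)%O ==> (meet_coef f S j != 0)]).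
  apply: leqif_sum => i _; rewrite big_ord1; apply: leqif_sum => j _.
  rewrite !mxE; case: (_ <= _)%O; last by rewrite mulr0 eqxx; exact: leqif_refl.
  rewrite mulr1 /=; case: (_ == _); last exact: leqif_refl.
  by split.
apply/forallP/forallP => [H i|H j]; first by apply/forall_inP.
by move/forall_inP: (H j); apply.
Qed.

End Nonzero.

Theorem proposition4p2 (R : realType) (disp : Order.disp_t)
  (P : bMeetSemilatticeType disp) (Pfin : locally_finite P)
  (n : nat) (S : n.-tuple P) (Suniq : uniq S) (Smeet : {in S &, forall x y, (x `&` y)%O \in S})
  (Sord : forall i j : 'I_n, (tnth S i <= tnth S j)%O -> (i <= j)%N)
  (f : P -> R[i]) (d : nat) :
  let N := (\sum_(z <- S) count (fun y => (y <= z)%O) S)%N in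
  [/\ tt_decomposition (meet_tensor (d := d.+1) f S)
        (core_first f S) (fun=> core_mid S) (core_last S),
      (nnz (core_first f S) <= N ?= iff [forall j, meet_coef f S j != 0%R])%N,
      nnz (core_mid (C := R[i]) S) = N
    & nnz (core_last (C := R[i]) S) = N].
Proof.
split; last exact: nnz_core_last.
- by move=> i; rewrite meet_tensorE// tt_entryE.
- exact: nnz_core_first.
- exact: nnz_core_mid.
Qed.
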